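(* Let $\beta>3$ with $\beta\ne4$. For each $\varepsilon>0$ set $\eta=(\beta-2)\sqrt{\frac{\beta-3}{\beta-1}}\,\varepsilon$, let $G$ be uniformly distributed on $[0,1]$, let $\xi$ be independent of $G$ with density $p^\xi(x)=(\beta-1)\eta^{\beta-1}x^{-\beta}$ for $x\ge\eta$ (and $0$ for $x<\eta$), and let $M=G+\xi$. Suppose that $\alpha=\alpha(\varepsilon)$ is chosen such that $m_{\alpha(\varepsilon)}=1+\eta$. Then, as $\varepsilon\to0^+$, $$\alpha(\varepsilon)\sim\sqrt{\frac{\beta-3}{\beta-1}}\;\varepsilon\qquad\text{and}\qquad \rho_{\alpha(\varepsilon)}\to\max\left\{-\sqrt{\frac{\beta-3}{2(\beta-2)}},\,-\frac1{\beta-2}\right\}.$$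
   Context: For $\alpha\in(0,1)$, $m_\alpha$ denotes the top-$\alpha$ quantile of $M$, i.e. $\mathbb P[M\ge m_\alpha]=\alpha$. A subscript $\alpha$ denotes conditioning on the event $M\ge m_\alpha$: $\mathbb E_\alpha[X]=\mathbb E[X\mid M\ge m_\alpha]$, and $\mathrm{Var}_\alpha$, $\mathrm{Cov}_\alpha$ are the corresponding conditional variance and covariance. The correlation among the top-$\alpha$ values of $M$ is $\rho_\alpha=\mathrm{Cov}_\alpha(G,M)/\sqrt{\mathrm{Var}_\alpha(G)\,\mathrm{Var}_\alpha(M)}$. $f\sim g$ means $f/g\to1$. *)

(* Defs.v *)
From HB Require Import structures.
From mathcomp Require Import all_boot all_order all_algebra.
From mathcomp Require Import all_classical all_reals all_analysis.

Set Implicit Arguments.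
Unset Strict Implicit.
Unset Printing Implicit Defensive.

Import Order.TTheory GRing.Theory Num.Theory.
Import numFieldTopology.Exports numFieldNormedType.Exports.

Local Open Scope classical_set_scope.
Local Open Scope ring_scope.

Section random_variables.
Context {d : measure_display} {T : measurableType d} {R : realType}.
Variable P : probability T R.

(* Laws are compared on measurable sets only: the measures of the library are
   total functions on [set R]. *)
Definition has_density (X : {RV P >-> R}) (p : R -> R) : Prop :=
  forall A : set R, measurable A ->
    distribution P X A = (\int[lebesgue_measure]_(x in A) (p x)%:E)%E.

Definition uniform01 (X : {RV P >-> R}) : Prop :=
  forall A : set R, measurable A ->
    distribution P X A = uniform_prob (@ltr01 R) A.

Definition independent_RV (X Y : {RV P >-> R}) : Prop :=
  forall A B : set R, measurable A -> measurable B ->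
    P (X @^-1` A `&` Y @^-1` B) = (P (X @^-1` A) * P (Y @^-1` B))%E.

Definition is_top_quantile (X : {RV P >-> R}) (m : R -> R) : Prop :=
  forall a : R, 0 < a < 1 -> P [set w | m a <= X w] = a%:E.

(* [cond_prob mA U = P (U `&` A) / P A] when [0 < P A]; [mnormalize] falls back
   on [P] itself when [P A = 0]. *)
Definition cond_prob (A : set T) (mA : measurable A) : probability T R :=
  mnormalize (mrestr P mA) P.

Lemma measurable_ge_RV (X : {RV P >-> R}) (t : R) :
  measurable [set w | t <= X w].
Proof.
have -> : [set w | t <= X w] = X @^-1` `[t, +oo[.
  by apply/seteqP; split => w /=; rewrite in_itv/= andbT.
exact: measurable_funPTI.
Qed.

(* Correlation of [X] and [Y] conditionally on the event [Y >= t]. *)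
Definition top_correlation (X Y : {RV P >-> R}) (t : R) : R :=
  let Q := cond_prob (measurable_ge_RV Y t) in
  fine (covariance Q X Y) / Num.sqrt (fine 'V_Q[X] * fine 'V_Q[Y]).

End random_variables.

Definition pareto_pdf {R : realType} (beta eta x : R) : R :=
  if eta <= x then (beta - 1) * eta `^ (beta - 1) * x `^ (- beta) else 0.

(* The [eta] for which the density [pareto_pdf beta eta] has variance [eps^2]. *)
Definition noise_scale {R : realType} (beta eps : R) : R :=
  (beta - 2) * Num.sqrt ((beta - 3) / (beta - 1)) * eps.

(* Main.v *)
(* Put U = 1 - G, Y = xi - eta, so that M = 1 + eta + (Y - U) and the event
   M >= 1 + eta is U <= Y, with U uniform on [0, 1] independent of Y >= 0.
   Integrating U out,
     E[U^i Y^j ; U <= Y] = E[Y^j min(1, Y)^(i+1)] / (i + 1),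
   and the right-hand side is elementary: expanding powers of Y = xi - eta and
   integrating against the Pareto density gives, with n = i + 1 + j, exactly
     A eta^n + B(eta) eta^(beta - 1),   B continuous at 0
   (beta <> 4 keeps the antiderivatives logarithm-free).  For i = j = 0 the
   first term dominates and gives alpha ~ eta / (beta - 2).  The second moments
   have n = 3: for beta > 4 the first term dominates (scale eta), for beta < 4
   the second one does (heavy tail of xi at scale 1), and then the squared
   first moments are negligible.  These are the two values in the maximum. *)

Require Import Defs.
From HB Require Import structures.
From mathcomp Require Import all_boot all_order all_algebra.
From mathcomp Require Import all_classical all_reals all_analysis.
From mathcomp Require Import measurable_realfun ring lra.

Set Implicit Arguments.
Unset Strict Implicit.
Unset Printing Implicit Defensive.

Import Order.TTheory GRing.Theory Num.Theory.
Import numFieldTopology.Exports numFieldNormedType.Exports.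

Local Open Scope classical_set_scope.
Local Open Scope ring_scope.

(** * Integration against a density *)

Section image_density.
Local Open Scope ereal_scope.
Context d d' (T : measurableType d) (S : measurableType d') (R : realType).
Variables (nu : {measure set T -> \bar R}) (mu : {measure set S -> \bar R}).
Variables (X : T -> S) (k : S -> R).
Hypotheses (mX : measurable_fun setT X) (mk : measurable_fun setT k).
Hypothesis k0 : forall x, (0 <= k x)%R.
Hypothesis nuE : forall A, measurable A ->
  nu (X @^-1` A) = \int[mu]_(x in A) (k x)%:E.

Import HBNNSimple.

Let integral_image_nnsfun (h : {nnsfun S >-> R}) :
  \int[pushforward nu X]_x (h x)%:E = \int[mu]_x ((h x)%:E * (k x)%:E).
Proof.
under [LHS]eq_integral do rewrite fimfunE -fsumEFin//.
rewrite [LHS]ge0_integral_fsum//; last 2 first.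
  - by move=> r; exact/measurable_EFinP/measurableT_comp.
  - by move=> n x _; rewrite EFinM nnfun_muleindic_ge0.
under [RHS]eq_integral.
  move=> x _; rewrite fimfunE -fsumEFin// ge0_mule_fsuml; last first.
    by move=> r; rewrite EFinM nnfun_muleindic_ge0.
  over.
rewrite [RHS]ge0_integral_fsum//; last 2 first.
  - move=> r; apply: emeasurable_funM; last exact/measurable_EFinP.
    exact/measurable_EFinP/measurableT_comp.
  - move=> n x _; apply: mule_ge0; last by rewrite lee_fin.
    by rewrite EFinM nnfun_muleindic_ge0.
apply: eq_fsbigr => r _.
under eq_integral do rewrite EFinM.
under [RHS]eq_integral do rewrite EFinM -muleA.
rewrite integralZl_indic_nnsfun//= integral_indic// setIT.
rewrite [X in r%:E * X](nuE (A := h @^-1` [set r]))//.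
(* The sum ranges over all real values [r]; for negative [r] the fibre of the nonnegative [h] is
   empty and both sides vanish. *)
have [r0|r0] := leP 0%R r.
  rewrite ge0_integralZl//; last 2 first.
    - by apply: emeasurable_funM; exact/measurable_EFinP.
    - by move=> x _; rewrite mule_ge0// lee_fin.
  congr (_ * _); rewrite [LHS]integral_mkcond; apply: eq_integral => x _.
  by rewrite patchE indicE; case: ifPn => _; rewrite ?mul1e ?mul0e.
rewrite preimage_nnfun0// integral_set0 mule0 integral0_eq// => x _.
by rewrite indic0 mul0e mule0.
Qed.

Let ge0_integral_image (f : S -> \bar R) : measurable_fun setT f ->
  (forall x, 0 <= f x) -> \int[nu]_x f (X x) = \int[mu]_x (f x * (k x)%:E).
Proof.
move=> mf f0.
transitivity (\int[pushforward nu X]_x f x).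
  by rewrite ge0_integral_pushforward// preimage_setT.
pose f_ := nnsfun_approx measurableT mf.
have f_f x : (EFin \o f_ ^~ x) n @[n --> \oo] --> f x.
  exact: cvg_nnsfun_approx.
transitivity (limn (fun n => \int[pushforward nu X]_x (f_ n x)%:E)).
  rewrite -monotone_convergence//=.
  - by apply: eq_integral => // x _; apply/esym/cvg_lim => //; exact: f_f.
  - by move=> n; exact/measurable_EFinP.
  - by move=> n x _; rewrite lee_fin.
  - by move=> x _ m n mn; rewrite lee_fin; exact/lefP/nd_nnsfun_approx.
transitivity (limn (fun n => \int[mu]_x ((f_ n x)%:E * (k x)%:E))).
  by apply: congr_lim; apply/funext => n; exact: integral_image_nnsfun.
rewrite -monotone_convergence//=.
- apply: eq_integral => x _; apply/cvg_lim => //.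
  by apply: cvgeZr => //; exact: f_f.
- by move=> n; apply: emeasurable_funM; exact/measurable_EFinP.
- by move=> n x _; rewrite mule_ge0 ?lee_fin.
- move=> x _ m n mn; rewrite lee_wpmul2r ?lee_fin//.
  exact/lefP/nd_nnsfun_approx.
Qed.

(** On simple functions this is [nuE], and monotone convergence extends it to nonnegative functions.
    Since k >= 0, multiplication by k commutes with taking positive and negative parts. *)
Lemma integral_image_density (f : S -> \bar R) : measurable_fun setT f ->
  \int[nu]_x f (X x) = \int[mu]_x (f x * (k x)%:E).
Proof.
move=> mf; rewrite integralE [RHS]integralE; congr (_ - _).
- transitivity (\int[nu]_x (f^\+ (X x))).
    by apply: eq_integral => x _; rewrite !funeposE.
  rewrite ge0_integral_image//; last first.
    exact: measurable_funepos.
  apply: eq_integral => x _; rewrite !funeposE.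
  by rewrite maxe_pMl ?mul0e ?lee_fin.
- transitivity (\int[nu]_x (f^\- (X x))).
    by apply: eq_integral => x _; rewrite !funenegE.
  rewrite ge0_integral_image//; last first.
    exact: measurable_funeneg.
  apply: eq_integral => x _; rewrite !funenegE.
  by rewrite maxe_pMl ?mul0e ?lee_fin// mulNe.
Qed.

End image_density.

Section joint_density.
Local Open Scope ereal_scope.
Context d (T : measurableType d) (R : realType) (P : probability T R).
Local Notation leb := (@lebesgue_measure R).
Local Notation RT := (measurableTypeR R).
Variables (X Y : {RV P >-> R}) (u p : R -> R).
Hypotheses (mfu : measurable_fun setT u) (mfp : measurable_fun setT p).
Hypotheses (u0 : forall x, (0 <= u x)%R) (p0 : forall x, (0 <= p x)%R).
Hypotheses (Xu : has_density X u) (Yp : has_density Y p).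
Hypothesis indXY : independent_RV X Y.

(** Independence says that the law of the pair agrees with the product of the marginal laws on
    rectangles, hence everywhere. Tonelli then allows each marginal law to be replaced by its
    density in turn. *)
Lemma joint_density (C : set (RT * RT)) : measurable C ->
  P ((fun t => (X t, Y t)) @^-1` C) =
  \int[(leb \x leb)%E]_(z in C) (u z.1 * p z.2)%:E.
Proof.
move=> mC.
(* [R] and [measurableTypeR R] have the same measurable sets but different
   displays; [lebesgue_measure] lives on the latter. *)
pose X' : {RV P >-> RT} := HB.pack (X : T -> RT)
  (isMeasurableFun.Build _ _ _ _ (X : T -> RT) (measurable_funPT X)).
pose Y' : {RV P >-> RT} := HB.pack (Y : T -> RT)
  (isMeasurableFun.Build _ _ _ _ (Y : T -> RT) (measurable_funPT Y)).
have mXY : measurable_fun setT (fun t => (X' t, Y' t)).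
  exact: measurable_fun_pair.
have -> : P ((fun t => (X t, Y t)) @^-1` C) =
    (distribution P X' \x distribution P Y') C.
  apply/esym; have /(_ mXY) := product_measure_unique
    (m1 := distribution P X') (m2 := distribution P Y')
    (m' := pushforward P (fun t => (X' t, Y' t))).
  by apply => // A B mA mB; exact: (indXY mA mB).
have m1C : measurable_fun setT (fun z => (\1_C z)%:E : \bar R).
  exact/measurable_EFinP/measurable_indic.
rewrite -[in LHS](setIT C) -integral_indic// fubini_tonelli2//=.
have mI (y : R) : measurable_fun setT (fun x : RT => (\1_C (x, y))%:E : \bar R).
  exact: measurable_fun_pair1 m1C.
have mF : measurable_fun setT
    (fun z : RT * RT => (\1_C z * (u z.1 * p z.2))%:E : \bar R).
  apply/measurable_EFinP; apply: measurable_funM => //.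
  apply: measurable_funM.
    exact: (measurableT_comp mfu measurable_fst).
  exact: (measurableT_comp mfp measurable_snd).
(* The transfer formula is applied to the law of [Y] with the identity as the map; below, likewise
   for [X]. *)
rewrite (@integral_image_density _ _ RT RT R (distribution P Y') leb id p)//;
  last first.
  by apply: measurable_fun_fubini_tonelli_G => // z; rewrite lee_fin.
transitivity (\int[leb \x leb]_z (\1_C z * (u z.1 * p z.2))%:E); last first.
  rewrite [RHS]integral_mkcond; apply: eq_integral => z _.
  by rewrite patchE indicE; case: ifPn => _; rewrite ?mul1r ?mul0r.
rewrite fubini_tonelli2//=; last first.
  by move=> z; rewrite lee_fin !mulr_ge0.
apply: eq_integral => y _; rewrite /fubini_G/=.
rewrite (@integral_image_density _ _ RT RT R (distribution P X') leb id u
  _ _ _ _ (fun x => (\1_C (x, y))%:E))//.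
rewrite -ge0_integralZr//; last 3 first.
  - by apply: emeasurable_funM => //; exact/measurable_EFinP.
  - by move=> x _; rewrite mule_ge0 ?lee_fin.
  - by rewrite lee_fin.
by apply: eq_integral => x _; rewrite -!EFinM mulrA.
Qed.

End joint_density.

(** * Integrals of shifted powers *)

Section antiderivative.
Context {R : realType}.
Implicit Types (n j : nat) (eta x beta : R).
Local Notation leb := (@lebesgue_measure R).

(** Up to the constant (beta - 1) eta^(beta - 1), this is Y^n times the Pareto density, where Y = xi
    - eta. *)
Definition shift_pow beta eta n x : R := (x - eta) ^+ n * x `^ (- beta).

(** The binomial expansion of [(x - eta) ^+ n], integrated term by term. A term with l + 1 = beta
    should be a logarithm but is 0 here by division by zero, hence the conditions [l.+1%:R != beta]
    below. *)
Definition shift_pow_prim beta eta n x : R :=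
  \sum_(l < n.+1) 'C(n, l)%:R * (- eta) ^+ (n - l) / (l.+1%:R - beta) *
    x `^ (l.+1%:R - beta).

Lemma is_derive_shift_pow_prim beta eta n x : 0 < x ->
  (forall l, (l <= n)%N -> l.+1%:R != beta) ->
  is_derive x 1 (shift_pow_prim beta eta n) (shift_pow beta eta n x).
Proof.
move=> x0 nbeta; rewrite /shift_pow (addrC x) exprDn mulr_suml.
have -> : shift_pow_prim beta eta n = \sum_(l < n.+1)
    (fun x => 'C(n, l)%:R * (- eta) ^+ (n - l) / (l.+1%:R - beta) *
              x `^ (l.+1%:R - beta)).
  by apply/funext => y; rewrite /shift_pow_prim fct_sumE.
apply: is_derive_sum => l.
apply: is_derive_eq.
  apply: is_deriveZ; exact: is_derive1_powR.
have nz : l.+1%:R - beta != 0 by rewrite subr_eq0 nbeta// -ltnS.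
rewrite -(@powR_mulrn _ x) ?ltW// -[in RHS]mulr_natr.
have -> : l.+1%:R - beta - 1 = l%:R - beta by rewrite -natr1; ring.
rewrite powRD ?(gt_eqF x0) ?implybT//.
rewrite /GRing.scale/=; field.
by rewrite nat1r.
Qed.

Lemma continuous_shift_pow beta eta n x : 0 < x ->
  {for x, continuous (shift_pow beta eta n)}.
Proof.
move=> x0; apply: cvgM.
  apply: (@cvg_comp _ _ _ (fun y => y - eta) (fun y => y ^+ n)); last first.
    exact: exprn_continuous.
  by apply: cvgB; [exact: cvg_id|exact: cvg_cst].
suff : {for x, continuous (fun y : R => y `^ (- beta))} by [].
apply: differentiable_continuous; apply/derivable1_diffP.
by apply: ex_derive; exact: is_derive1_powR.
Qed.

Lemma continuous_shift_pow_prim beta eta n x : 0 < x ->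
  (forall l, (l <= n)%N -> l.+1%:R != beta) ->
  {for x, continuous (shift_pow_prim beta eta n)}.
Proof.
move=> x0 nbeta; apply: differentiable_continuous; apply/derivable1_diffP.
by apply: ex_derive; exact: is_derive_shift_pow_prim.
Qed.

Lemma integral_shift_pow_itv beta eta n a b : 0 < a -> a < b ->
  (forall l, (l <= n)%N -> l.+1%:R != beta) ->
  (\int[leb]_(x in `[a, b]) (shift_pow beta eta n x)%:E =
   (shift_pow_prim beta eta n b - shift_pow_prim beta eta n a)%:E)%E.
Proof.
move=> a0 ab nbeta; rewrite EFinB; apply: continuous_FTC2 => //.
- apply: continuous_in_subspaceT => x /[!inE]/=.
  rewrite in_itv/= => /andP[ax _].
  by apply: continuous_shift_pow; exact: lt_le_trans ax.
- split.
  + move=> x; rewrite in_itv/= => /andP[ax _].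
    apply: ex_derive; apply: is_derive_shift_pow_prim => //.
    exact: lt_trans ax.
  + by apply: cvg_at_right_filter; exact: continuous_shift_pow_prim.
  + apply: cvg_at_left_filter; apply: continuous_shift_pow_prim => //.
    exact: lt_trans ab.
- move=> x; rewrite in_itv/= => /andP[ax _].
  have x0 : 0 < x by exact: lt_trans ax.
  by rewrite derive1E; have [_ ->] := is_derive_shift_pow_prim eta x0 nbeta.
Qed.

Lemma cvg_powR_pinfty (r : R) : r < 0 -> x `^ r @[x --> +oo] --> (0 : R).
Proof.
move=> r0; apply/cvgr0Pnorm_lt => e e0; near=> x.
(* As r < 0, x^r < e holds as soon as x > e^(1/r). *)
have y0 : 0 < e `^ r^-1 by rewrite powR_gt0.
have yx : e `^ r^-1 < x by near: x; exact: nbhs_pinfty_gt.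
have x0 := lt_trans y0 yx.
rewrite ger0_norm ?powR_ge0// -[r]opprK powRN.
rewrite -[ltRHS]invrK ltf_pV2 ?posrE ?invr_gt0 ?powR_gt0//.
have -> : e^-1 = (e `^ r^-1) `^ (- r).
  by rewrite -powRrM mulrN mulVf ?lt_eqF// powR_inv1// ltW.
apply: gt0_ltr_powR => //; first by rewrite oppr_gt0.
- by rewrite nnegrE ltW.
- by rewrite nnegrE ltW.
Unshelve. all: by end_near. Qed.

(** All exponents l + 1 - beta are negative, so the primitive vanishes at infinity and only the
    lower endpoint contributes. *)
Lemma integral_shift_pow_infty beta eta n a : 0 < a -> eta <= a ->
  n.+1%:R < beta ->
  (\int[leb]_(x in `[a, +oo[) (shift_pow beta eta n x)%:E =
   (- shift_pow_prim beta eta n a)%:E)%E.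
Proof.
move=> a0 etaa nbeta.
have lbeta l : (l <= n)%N -> l.+1%:R < beta.
  by move=> ln; apply: le_lt_trans nbeta; rewrite ler_nat.
have nebeta l : (l <= n)%N -> l.+1%:R != beta by move=> /lbeta/lt_eqF->.
have -> : (- shift_pow_prim beta eta n a)%:E =
    (0%:E - (shift_pow_prim beta eta n a)%:E)%E by rewrite sub0e EFinN.
apply: ge0_continuous_FTC2y => //.
- move=> x ax; rewrite mulr_ge0 ?powR_ge0// exprn_ge0// subr_ge0.
  exact: le_trans ax.
- apply: continuous_in_subspaceT => x /[!inE]/=; rewrite in_itv/= andbT => ax.
  by apply: continuous_shift_pow; exact: lt_le_trans ax.
- rewrite /shift_pow_prim.
  rewrite [X in _ --> X](_ : 0 = \sum_(l < n.+1)
      ('C(n, l)%:R * (- eta) ^+ (n - l) / (l.+1%:R - beta) * 0)); last first.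
    by rewrite big1// => l _; rewrite mulr0.
  apply: cvg_big => [|l _]; first exact: add_continuous.
  apply: cvgMr; apply: cvg_powR_pinfty.
  by rewrite subr_lt0 lbeta// -ltnS.
- move=> x ax; apply: ex_derive; apply: is_derive_shift_pow_prim => //.
  exact: lt_trans ax.
- by apply: cvg_at_right_filter; exact: continuous_shift_pow_prim.
- move=> x; rewrite in_itv/= andbT => ax.
  have x0 : 0 < x by exact: lt_trans ax.
  by rewrite derive1E; have [_ ->] := is_derive_shift_pow_prim eta x0 nebeta.
Qed.

(** Serves to integrate out the uniform variable: with x the value of G and U = 1 - G, the
    constraint U <= s reads x >= 1 - s. *)
Lemma integral_onem_pow i (s : R) : 0 <= s ->
  (\int[leb]_(x in `[(1 - s)%R, 1%R]) ((1 - x) ^+ i)%:E =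
   (s ^+ i.+1 / i.+1%:R)%:E)%E.
Proof.
rewrite le_eqVlt => /predU1P[<-|s0].
  by rewrite subr0 set_itv1 integral_set1 expr0n/= mul0r.
pose F (x : R) : R := - ((1 - x) ^+ i.+1 / i.+1%:R).
have dF (x : R) : is_derive x 1 F ((1 - x) ^+ i).
  have -> : F = (- i.+1%:R^-1) *: ((cst 1 - id) ^+ i.+1).
    by apply/funext => y; rewrite /F !fctE mulrC -mulNr.
  apply: is_derive_eq; rewrite /GRing.scale/= !fctE.
  by field; rewrite nat1r pnatr_eq0.
have cF (x : R) : {for x, continuous F}.
  by apply: differentiable_continuous; apply/derivable1_diffP.
rewrite (@continuous_FTC2 _ _ F).
- rewrite -EFinB; congr EFin.
  by rewrite /F subKr subrr expr0n/= mul0r oppr0 sub0r opprK.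
- by rewrite ltrBlDr ltrDl.
- apply: continuous_in_subspaceT => x _.
  apply: (@cvg_comp _ _ _ (fun y => 1 - y) (fun y => y ^+ i)); last first.
    exact: exprn_continuous.
  by apply: cvgB; [exact: cvg_cst|exact: cvg_id].
- split => //.
  + by apply: cvg_at_right_filter; exact: cF.
  + by apply: cvg_at_left_filter; exact: cF.
- by move=> x _; rewrite derive1E; have [_ ->] := dF x.
Qed.

End antiderivative.

(** * Closed form of the moments on the top event *)

Section moments.
Context {R : realType}.
Implicit Types beta eta : R.
Local Notation leb := (@lebesgue_measure R).

Lemma measurable_shift_pow beta eta n :
  measurable_fun setT (shift_pow beta eta n).
Proof.
apply: measurable_funM; last exact: measurable_powR.
by apply: measurable_funX; exact: measurable_funB.
Qed.

(** The minimum switches at x = 1 + eta. Below, the integrand is a shifted power of order i + j on a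
    bounded interval, where beta only has to avoid logarithms; above, it has order j, and j + 1 <
    beta gives convergence. *)
Lemma integral_shift_pow_min beta eta i j : 0 < eta -> j.+1%:R < beta ->
  (forall l, (l <= i + j)%N -> l.+1%:R != beta) ->
  (\int[leb]_(x in `[eta, +oo[)
     (shift_pow beta eta j x * Num.min 1 (x - eta) ^+ i)%:E =
   (shift_pow_prim beta eta (i + j) (1 + eta) -
    shift_pow_prim beta eta (i + j) eta -
    shift_pow_prim beta eta j (1 + eta))%:E)%E.
Proof.
move=> eta0 jbeta nbeta.
have eta1 : eta < 1 + eta by rewrite ltrDr.
have mf : measurable_fun setT
    (fun x : R => (shift_pow beta eta j x * Num.min 1 (x - eta) ^+ i)%:E).
  apply/measurable_EFinP; apply: measurable_funM.
    exact: measurable_shift_pow.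
  apply: measurable_funX; apply: measurable_minr => //.
  exact: measurable_funB.
have -> : `[eta, +oo[%classic = `[eta, 1 + eta] `|` `]1 + eta, +oo[.
  by rewrite -itv_bndbnd_setU// bnd_simp ltW.
rewrite ge0_integral_setU//=; last 3 first.
- exact: measurable_funTS.
- move=> x xD; have etax : 0 <= x - eta.
    rewrite subr_ge0; case: xD; rewrite /= in_itv/=; first by case/andP.
    by rewrite andbT => /(lt_trans eta1)/ltW.
  by rewrite lee_fin !mulr_ge0 ?powR_ge0 ?exprn_ge0// le_min ler01.
- apply/disj_setPS => x [] /=; rewrite !in_itv/= andbT => /andP[_ xeta].
  by rewrite ltNge xeta.
rewrite (EFinD _ (- shift_pow_prim beta eta j _)); congr (_ + _)%E.
  rewrite -integral_shift_pow_itv//; apply: eq_integral => x.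
  rewrite inE/= in_itv/= => /andP[_ x1]; congr EFin.
  by rewrite min_r ?lerBlDr// /shift_pow mulrAC -exprD addnC.
rewrite integral_itv_obnd_cbnd; last exact: measurable_funTS.
rewrite -integral_shift_pow_infty ?(ltW eta1)//; last first.
  exact: lt_trans eta1.
apply: eq_integral => x; rewrite inE/= in_itv/= andbT => x1; congr EFin.
by rewrite min_l ?lerBrDr// expr1n mulr1.
Qed.

(* E[(1 - G)^i (xi - eta)^j ; M >= 1 + eta] *)
Definition top_moment beta eta i j : R :=
  (beta - 1) * eta `^ (beta - 1) / i.+1%:R *
  (shift_pow_prim beta eta (i.+1 + j) (1 + eta) -
   shift_pow_prim beta eta (i.+1 + j) eta -
   shift_pow_prim beta eta j (1 + eta)).

End moments.

(** * Conditioning on the top event *)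

Lemma mnormalize_EFin d (T : measurableType d) (R : realType)
    (mu : {measure set T -> \bar R}) (P : probability T R) (c : R) A :
  0 < c -> mu setT = c%:E -> mnormalize mu P A = (mu A * (c^-1)%:E)%E.
Proof. by move=> c0 muE; rewrite /mnormalize muE eqe (gt_eqF c0). Qed.

Lemma measurable_top_sum {R : realType} (t : R) :
  measurable ([set z | t <= z.1 + z.2] :
    set (measurableTypeR R * measurableTypeR R)).
Proof.
rewrite -[X in measurable X]setTI.
apply: (@measurable_fun_le _ (measurableTypeR R * measurableTypeR R)%type R
  setT (cst t) (fun z => z.1 + z.2)) => //.
by apply: measurable_funD; [exact: measurable_fst|exact: measurable_snd].
Qed.

Section cond_expectation.
Local Open Scope ereal_scope.
Context d (T : measurableType d) (R : realType) (P : probability T R).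
Local Notation leb := (@lebesgue_measure R).
Local Notation RT := (measurableTypeR R).
Variables (X Y M : {RV P >-> R}) (u p : R -> R) (t alpha : R).
Hypotheses (mfu : measurable_fun setT u) (mfp : measurable_fun setT p).
Hypotheses (u0 : forall x, (0 <= u x)%R) (p0 : forall x, (0 <= p x)%R).
Hypotheses (Xu : has_density X u) (Yp : has_density Y p).
Hypothesis indXY : independent_RV X Y.
Hypothesis ME : forall w, M w = (X w + Y w)%R.
Hypothesis alpha0 : (0 < alpha)%R.
Hypothesis Palpha : P [set w | (t <= M w)%R] = alpha%:E.

Let Q := cond_prob P (measurable_ge_RV M t).
Let H : set (RT * RT) := [set z | (t <= z.1 + z.2)%R].

Lemma cond_probE A : measurable A ->
  Q A = P (A `&` [set w | (t <= M w)%R]) * (alpha^-1)%:E.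
Proof.
move=> mA; apply: mnormalize_EFin => //.
by rewrite -Palpha -[in RHS](setTI [set w | _]).
Qed.

(** Under [Q] the pair (X, Y) has density u(x) p(y) 1_H / alpha with respect to planar Lebesgue
    measure, so the transfer formula applies. *)
Lemma integral_cond_prob (f : RT * RT -> R) : measurable_fun setT f ->
  \int[Q]_w (f (X w, Y w))%:E =
  \int[(leb \x leb)%E]_z (f z * (u z.1 * p z.2 * \1_H z / alpha))%:E.
Proof.
move=> mf.
have mH : measurable H by exact: (measurable_top_sum t).
have mXY : measurable_fun setT (fun w => (X w, Y w) : RT * RT).
  exact: (measurable_fun_pair (measurable_funPT X) (measurable_funPT Y)).
have mup : measurable_fun setT (fun z : RT * RT => (u z.1 * p z.2)%R).
  apply: measurable_funM.
    exact: (measurableT_comp mfu measurable_fst).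
  exact: (measurableT_comp mfp measurable_snd).
have mk : measurable_fun setT
    (fun z : RT * RT => (u z.1 * p z.2 * \1_H z / alpha)%R).
  by apply: measurable_funM => //; apply: measurable_funM.
rewrite (@integral_image_density _ _ T (RT * RT)%type R Q (leb \x leb)
  (fun w => (X w, Y w)) (fun z => (u z.1 * p z.2 * \1_H z / alpha)%R) mXY mk _ _
  (fun z => (f z)%:E))//.
- by move=> z; rewrite !mulr_ge0// invr_ge0 ltW.
- move=> A mA; have mXYA : measurable ((fun w => (X w, Y w)) @^-1` A).
    by rewrite -[X in measurable X]setTI; exact: mXY.
  rewrite [LHS](cond_probE mXYA).
  (* As M = X + Y, the conditioning event is itself a preimage under the pair. *)
  rewrite (_ : _ `&` _ = (fun w => (X w, Y w)) @^-1` (A `&` H)); last first.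
    by apply/seteqP; split => w /=; rewrite /H/= ME.
  rewrite (joint_density mfu mfp)//; last exact: measurableI.
  rewrite -ge0_integralZr//; last 4 first.
  + exact: measurableI.
  + by apply/measurable_EFinP; exact: measurable_funTS.
  + by move=> z _; rewrite lee_fin mulr_ge0.
  + by rewrite lee_fin invr_ge0 ltW.
  rewrite integral_mkcondr; apply: eq_integral => z _.
  rewrite patchE indicE -EFinM.
  by case: ifPn => _; rewrite ?mulr1// mulr0 mul0r.
- exact/measurable_EFinP.
Qed.

End cond_expectation.

(** * Conditional moments and correlation *)

Section top_moments.
Context d (T : measurableType d) (R : realType) (P : probability T R).
Local Notation leb := (@lebesgue_measure R).
Local Notation RT := (measurableTypeR R).
Variables (G xi M : {RV P >-> R}) (beta eta alpha : R).
Hypotheses (beta1 : 1 < beta) (eta0 : 0 < eta) (alpha0 : 0 < alpha).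
Hypothesis G_uniform : uniform01 G.
Hypothesis xi_density : has_density xi (pareto_pdf beta eta).
Hypothesis indep : independent_RV G xi.
Hypothesis ME : forall w, M w = G w + xi w.
Hypothesis Palpha : P [set w | 1 + eta <= M w] = alpha%:E.

Lemma pareto_pdf_ge0 x : 0 <= pareto_pdf beta eta x.
Proof.
rewrite /pareto_pdf; case: ifP => // _.
by rewrite !mulr_ge0 ?powR_ge0// subr_ge0 ltW.
Qed.

Lemma measurable_pareto_pdf : measurable_fun setT (pareto_pdf beta eta).
Proof.
apply: measurable_fun_ifT => //; first exact: measurable_fun_ler.
by apply: measurable_funM => //; exact: measurable_powR.
Qed.

Lemma integral_top_moment i j : j.+1%:R < beta ->
  (forall l, (l <= i.+1 + j)%N -> l.+1%:R != beta) ->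
  (\int[cond_prob P (measurable_ge_RV M (1 + eta))]_w
    ((1 - G w) ^+ i * (xi w - eta) ^+ j)%:E =
   (top_moment beta eta i j / alpha)%:E)%E.
Proof.
move=> jbeta nbeta.
have G_density : has_density G (uniform_pdf 0 1) by exact: G_uniform.
have u0 (x : R) : 0 <= uniform_pdf 0 1 x by exact: uniform_pdf_ge0.
pose f (z : RT * RT) := (1 - z.1) ^+ i * (z.2 - eta) ^+ j.
have mf : measurable_fun setT f.
  by apply: measurable_funM; apply: measurable_funX; apply: measurable_funB.
pose H : set (RT * RT) := [set z | 1 + eta <= z.1 + z.2].
rewrite (integral_cond_prob (measurable_uniform_pdf _ _)
  measurable_pareto_pdf u0 pareto_pdf_ge0 G_density
  xi_density indep ME alpha0 Palpha mf).
have mH : measurable H by exact: (measurable_top_sum (1 + eta)).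
rewrite fubini_tonelli2/=; last 2 first.
- apply/measurable_EFinP; apply: measurable_funM => //.
  apply: measurable_funM => //; apply: measurable_funM => //.
  apply: measurable_funM.
    exact: (measurableT_comp (measurable_uniform_pdf _ _) measurable_fst).
  exact: (measurableT_comp measurable_pareto_pdf measurable_snd).
(* Tonelli needs a nonnegative integrand: [f] may be negative, but only where one of the two
   densities vanishes. *)
- move=> [x y]/=; rewrite lee_fin.
  rewrite /uniform_pdf; case: ifPn => [/andP[x0 x1]|_]; last first.
    by rewrite !mul0r mulr0.
  rewrite /pareto_pdf; case: ifPn => [yeta|_]; last first.
    by rewrite mulr0 !mul0r mulr0.
  have b1 : 0 <= beta - 1 by rewrite subr_ge0 ltW.
  by rewrite /f/= !mulr_ge0 ?exprn_ge0 ?powR_ge0 ?invr_ge0 ?subr_ge0 ?ler01//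
    ltW.
(* The intermediate form after integrating x out, which replaces (1 - x)^i by min(1, y - eta)^(i +
   1) / (i + 1). *)
transitivity (\int[leb]_(y in `[eta, +oo[)
    (((beta - 1) * eta `^ (beta - 1) / i.+1%:R / alpha)%:E *
     (shift_pow beta eta j y * Num.min 1 (y - eta) ^+ i.+1)%:E))%E; last first.
  rewrite ge0_integralZl//; last 3 first.
  - apply/measurable_EFinP; apply: measurable_funTS; apply: measurable_funM.
      exact: measurable_shift_pow.
    apply: measurable_funX; apply: measurable_minr => //.
    exact: measurable_funB.
  - move=> y; rewrite /= in_itv/= andbT => etay.
    rewrite lee_fin !mulr_ge0 ?powR_ge0 ?exprn_ge0//.
      by rewrite subr_ge0.
    by rewrite le_min ler01 subr_ge0.
  - by rewrite lee_fin !mulr_ge0 ?powR_ge0 ?invr_ge0 ?subr_ge0// ltW.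
  rewrite integral_shift_pow_min// -EFinM; congr EFin.
  by rewrite /top_moment; ring.
rewrite [RHS]integral_mkcond; apply: eq_integral => y _.
rewrite patchE mem_setE/= in_itv/= andbT /fubini_G/=.
case: ifPn => [etay|yeta]; last first.
  rewrite integral0_eq// => x _.
  by rewrite /pareto_pdf (negbTE yeta) mulr0 !mul0r mulr0.
have s0 : 0 <= Num.min 1 (y - eta) by rewrite le_min ler01 subr_ge0.
(* For fixed y >= eta, the constraints 0 <= x <= 1 and x + y >= 1 + eta describe exactly this
   interval. *)
transitivity (\int[leb]_(x in `[(1 - Num.min 1 (y - eta))%R, 1%R])
    (((y - eta) ^+ j * pareto_pdf beta eta y / alpha)%:E *
     ((1 - x) ^+ i)%:E))%E.
  rewrite [RHS]integral_mkcond; apply: eq_integral => x _.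
  rewrite patchE /uniform_pdf indicE.
  have -> : ((x, y) \in [set z | 1 + eta <= z.1 + z.2]) = (1 + eta <= x + y).
    by apply/idP/idP; rewrite inE.
  have -> : (x \in `[(1 - Num.min 1 (y - eta))%R, 1%R]%classic) =
      (0 <= x <= 1) && (1 + eta <= x + y).
    rewrite mem_setE in_itv/= lerBlDl -lerBlDr le_min.
    apply/idP/idP => /andP[/andP[? ?] ?];
      by repeat (apply/andP; split); lra.
  case: ifPn => [_|_] /=; last by rewrite !mul0r mulr0.
  case: ifPn => _; last by rewrite mulr0 mul0r mulr0.
  by rewrite -EFinM; congr EFin; rewrite /f/= subr0 invr1; ring.
rewrite ge0_integralZl//; last 3 first.
- apply/measurable_EFinP; apply: measurable_funTS; apply: measurable_funX.
  exact: measurable_funB.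
- move=> x; rewrite /= in_itv/= => /andP[_ x1].
  by rewrite lee_fin exprn_ge0// subr_ge0.
- rewrite lee_fin !mulr_ge0 ?pareto_pdf_ge0 ?exprn_ge0 ?subr_ge0//.
  by rewrite invr_ge0 ltW.
rewrite integral_onem_pow// -!EFinM; congr EFin.
by rewrite /pareto_pdf etay /shift_pow; ring.
Qed.

End top_moments.

Section correlation_of_moments.
Context {R : realType}.
Implicit Type e : nat -> nat -> R.

(* [e i j] stands for the mixed moment E(U^i V^j). *)
Definition var_l e : R := e 2%N 0%N - e 1%N 0%N ^+ 2.

Definition var_r e : R := e 0%N 2%N - e 0%N 1%N ^+ 2.

Definition cov_lr e : R := e 1%N 1%N - e 1%N 0%N * e 0%N 1%N.

Definition var_diff e : R := var_r e + var_l e - 2 * cov_lr e.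

(* The correlation of a - U and b + V - U. *)
Definition correlation_of_moments e : R :=
  (var_l e - cov_lr e) / Num.sqrt (var_l e * var_diff e).

End correlation_of_moments.

Section second_moments.
Local Open Scope ereal_scope.
Context d (T : measurableType d) (R : realType) (Q : probability T R).
Implicit Types U V : T -> R.

Lemma Lfun2_expectation U (e : R) : measurable_fun setT U ->
  \int[Q]_w (U w ^+ 2)%:E = e%:E -> U \in Lfun Q 2%:E.
Proof.
move=> mU UE; rewrite inE; apply/andP; split; rewrite inE//=.
rewrite /finite_norm unlock poweR_lty//.
under eq_integral do rewrite /= powR_mulrn// real_normK ?num_real//.
by rewrite UE ltry.
Qed.

Lemma Lfun2D U V : U \in Lfun Q 2%:E -> V \in Lfun Q 2%:E ->
  (U \+ V)%R \in Lfun Q 2%:E.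
Proof.
have p12 : 1 <= 2%:E :> \bar R by rewrite lee_fin ler1n.
exact: (proj2 (Lfun_addr_closed Q p12)).
Qed.

Lemma Lfun2B U V : U \in Lfun Q 2%:E -> V \in Lfun Q 2%:E ->
  (U \- V)%R \in Lfun Q 2%:E.
Proof.
move=> LU LV; apply: (@Lfun2D U (\- V)%R LU).
by rewrite rpredN.
Qed.

Variables (U V : T -> R) (e : nat -> nat -> R).
Hypotheses (mU : measurable_fun setT U) (mV : measurable_fun setT V).
Hypothesis eE : forall i j, (i + j <= 2)%N ->
  \int[Q]_w (U w ^+ i * V w ^+ j)%:E = (e i j)%:E.

Let EU : \int[Q]_w (U w)%:E = (e 1 0)%:E.
Proof. by rewrite -eE//; apply: eq_integral => w _; rewrite expr0 mulr1. Qed.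

Let EV : \int[Q]_w (V w)%:E = (e 0 1)%:E.
Proof. by rewrite -eE//; apply: eq_integral => w _; rewrite expr0 mul1r. Qed.

Let EUU : \int[Q]_w (U w ^+ 2)%:E = (e 2 0)%:E.
Proof. by rewrite -eE//; apply: eq_integral => w _; rewrite expr0 mulr1. Qed.

Let EUV : \int[Q]_w (U w * V w)%:E = (e 1 1)%:E.
Proof. by rewrite -eE. Qed.

Let EVV : \int[Q]_w (V w ^+ 2)%:E = (e 0 2)%:E.
Proof. by rewrite -eE//; apply: eq_integral => w _; rewrite expr0 mul1r. Qed.

Let LU : U \in Lfun Q 2%:E := Lfun2_expectation mU EUU.
Let LV : V \in Lfun Q 2%:E := Lfun2_expectation mV EVV.

Let varU : 'V_Q[U] = (var_l e)%:E.
Proof. by rewrite varianceE// unlock EU EUU -EFin_expe. Qed.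

Let varV : 'V_Q[V] = (var_r e)%:E.
Proof. by rewrite varianceE// unlock EV EVV -EFin_expe. Qed.

Let covUV : covariance Q U V = (cov_lr e)%:E.
Proof.
rewrite covarianceE ?Lfun2_mul_Lfun1 ?Lfun_subset12 ?fin_num_measure//.
by rewrite unlock EU EV EUV.
Qed.

(** Constants drop out by bilinearity, and -Cov(U, V - U) = Var(U) - Cov(U, V). *)
Lemma covariance_sub_cst (a b : R) :
  covariance Q (cst a \- U)%R (cst b \+ (V \- U))%R = (var_l e - cov_lr e)%:E.
Proof.
have LVU : (V \- U)%R \in Lfun Q 2%:E by exact: Lfun2B.
rewrite (covarianceBl _ LU (Lfun2D _ LVU)) ?Lfun_cst//.
rewrite covariance_cst_l covarianceDr ?Lfun_cst// covariance_cst_r.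
rewrite covarianceBr// -[covariance Q U U]/('V_Q[U]) varU covUV.
by rewrite !add0e -EFinB -EFinN; congr EFin; ring.
Qed.

Lemma variance_sub_cst (a : R) : 'V_Q[(cst a \- U)%R] = (var_l e)%:E.
Proof. by rewrite varianceB_cst_l. Qed.

Lemma variance_cst_sub (b : R) :
  'V_Q[(cst b \+ (V \- U))%R] = (var_diff e)%:E.
Proof.
have LVU : (V \- U)%R \in Lfun Q 2%:E by exact: Lfun2B.
rewrite varianceD_cst_l// varianceB// varU varV covarianceC covUV.
by rewrite -EFinM -EFinN -!EFinD.
Qed.

End second_moments.

Lemma top_correlationE d (T : measurableType d) (R : realType)
    (P : probability T R) (G xi M : {RV P >-> R}) (beta eta alpha : R) :
  3 < beta -> beta != 4 -> 0 < eta -> 0 < alpha ->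
  uniform01 G -> has_density xi (pareto_pdf beta eta) ->
  independent_RV G xi -> (forall w, M w = G w + xi w) ->
  P [set w | 1 + eta <= M w] = alpha%:E ->
  let e i j := top_moment beta eta i j / alpha in
  alpha = top_moment beta eta 0 0 /\
  top_correlation G M (1 + eta) =
    correlation_of_moments e.
Proof.
move=> beta3 beta4 eta0 alpha0 Gu xid ind ME Pa e.
have beta1 : 1 < beta by lra.
have EQ i j : (i + j <= 2)%N ->
  (\int[cond_prob P (measurable_ge_RV M (1 + eta))]_w
    ((1 - G w) ^+ i * (xi w - eta) ^+ j)%:E = (e i j)%:E)%E.
  move=> ij; apply: (integral_top_moment beta1 eta0 alpha0 Gu xid ind ME Pa).
    apply: le_lt_trans beta3; rewrite ler_nat ltnS.
    exact: leq_trans (leq_addl _ _) ij.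
  (* Since l <= 3, the exponent l + 1 = 4 is excluded by [beta != 4], and the smaller ones by beta >
     3. *)
  move=> l /leq_trans/(_ (ij : (i.+1 + j <= 3)%N)).
  rewrite leq_eqVlt => /predU1P[->|].
    by rewrite eq_sym.
  rewrite ltnS => l2; rewrite lt_eqF//; apply: le_lt_trans beta3.
  by rewrite ler_nat.
split.
  (* The moment of order (0, 0) is the total mass of the conditional law, that is 1. *)
  have := EQ 0%N 0%N isT; rewrite /e.
  under eq_integral do rewrite !expr0 mul1r.
  rewrite integral_cst// mul1e [LHS]probability_setT => -[].
  by move=> /esym/divr1_eq.
set Q := cond_prob P (measurable_ge_RV M (1 + eta)) in EQ *.
pose U w := 1 - G w; pose V w := xi w - eta.
have mU : measurable_fun setT U by exact: measurable_funB.
have mV : measurable_fun setT V by exact: measurable_funB.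
have GE : G = (cst 1 \- U) :> (T -> R).
  by apply/funext => w; rewrite /= subKr.
have MVE : M = (cst (1 + eta) \+ (V \- U)) :> (T -> R).
  by apply/funext => w; rewrite ME /= /U /V; ring.
rewrite /top_correlation -/Q GE MVE.
rewrite (covariance_sub_cst mU mV EQ).
by rewrite (variance_sub_cst mU EQ) (variance_cst_sub mU mV EQ).
Qed.

(** * Asymptotics *)

Section limits.
Context {R : realType}.
Implicit Types (beta eta r q : R) (i j n : nat).

(** Every term of the primitive has total degree n + 1 - beta in eta and x jointly. Against the
    Pareto factor eta^(beta - 1) this yields an exact multiple of eta^n. *)
Lemma shift_pow_prim_homogeneous beta eta n : 0 < eta ->
  shift_pow_prim beta eta n eta =
  eta `^ (n.+1%:R - beta) * shift_pow_prim beta 1 n 1.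
Proof.
move=> eta0; rewrite /shift_pow_prim mulr_sumr; apply: eq_bigr => l _.
rewrite powR1 mulr1 [in LHS]exprNn [in RHS]exprNn expr1n.
have -> : n.+1%:R - beta = (n - l)%:R + (l.+1%:R - beta).
  by rewrite addrA -natrD addnS subnK// -ltnS.
by rewrite [in RHS]powRD ?(gt_eqF eta0) ?implybT// powR_mulrn ?ltW//; ring.
Qed.

Lemma cvg_shift_pow_prim beta n :
  shift_pow_prim beta eta n (1 + eta) @[eta --> 0^'+] -->
    shift_pow_prim beta 0 n 1.
Proof.
apply: cvg_at_right_filter; rewrite /shift_pow_prim.
apply: cvg_big => [|l _]; first exact: add_continuous.
apply: cvgM.
  apply: cvgM; last exact: cvg_cst.
  apply: cvgM; first exact: cvg_cst.
  apply: (@cvg_comp _ _ _ (fun y : R => - y) (fun y => y ^+ (n - l)));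
    last first.
    exact: exprn_continuous.
  by apply: cvgN; exact: cvg_id.
apply: (@cvg_comp _ _ _ (fun y : R => 1 + y)
  (fun y => y `^ (l.+1%:R - beta)) _ (nbhs (1 : R))).
  have : 1 + y @[y --> (0 : R)] --> (1 + 0 : R).
    by apply: cvgD; [exact: cvg_cst|exact: cvg_id].
  by rewrite addr0.
suff : {for 1, continuous (fun y : R => y `^ (l.+1%:R - beta))} by [].
apply: differentiable_continuous; apply/derivable1_diffP.
by apply: ex_derive; apply: is_derive1_powR.
Qed.

(** With zero shift, only the top term l = n of the binomial expansion survives. *)
Lemma shift_pow_prim01 beta n : shift_pow_prim beta 0 n 1 = (n.+1%:R - beta)^-1.
Proof.
rewrite /shift_pow_prim big_ord_recr/= subnn expr0 binn powR1 !mulr1 mul1r.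
rewrite big1 ?add0r// => l _.
by rewrite oppr0 expr0n subn_eq0 leqNgt ltn_ord/= mulr0 !mul0r.
Qed.

Lemma cvg_powR_at_right0 r : 0 <= r ->
  eta `^ r @[eta --> 0^'+] --> ((r == 0)%:R : R).
Proof.
rewrite le_eqVlt => /predU1P[<-|r0].
  rewrite eqxx (_ : (fun eta : R => eta `^ 0) = cst 1); first exact: cvg_cst.
  by apply/funext => x; rewrite powRr0.
by rewrite gt_eqF//; exact: powR_cvg0.
Qed.

(* The limit of [top_moment beta eta i j / eta `^ r] as eta -> 0^+; the two
   boolean factors select the terms of order exactly r. *)
Definition top_moment_lim beta i j r : R :=
  (beta - 1) / i.+1%:R *
  ((beta - 1 - r == 0)%:R *
     (((i.+1 + j).+1%:R - beta)^-1 - (j.+1%:R - beta)^-1) -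
   ((i.+1 + j)%:R - r == 0)%:R * shift_pow_prim beta 1 (i.+1 + j) 1).

(** With n = i + 1 + j, the moment is a combination of eta^(beta - 1), with a coefficient continuous
    at 0, and of eta^n. The two bounds on r keep both exponents nonnegative after division by
    eta^r. *)
Lemma cvg_top_moment beta i j r : r <= beta - 1 -> r <= (i.+1 + j)%:R ->
  top_moment beta eta i j / eta `^ r @[eta --> 0^'+] -->
    (top_moment_lim beta i j r : R).
Proof.
move=> rbeta rn; set n := (i.+1 + j)%N in rn *.
have : (beta - 1) / i.+1%:R * (eta `^ (beta - 1 - r) *
    (shift_pow_prim beta eta n (1 + eta) - shift_pow_prim beta eta j (1 + eta))
    - eta `^ (n%:R - r) * shift_pow_prim beta 1 n 1) @[eta --> 0^'+] -->
    (top_moment_lim beta i j r : R).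
  apply: cvgM; first exact: cvg_cst.
  apply: cvgB; apply: cvgM.
  - by apply: cvg_powR_at_right0; rewrite subr_ge0.
  - by rewrite -!shift_pow_prim01; apply: cvgB; exact: cvg_shift_pow_prim.
  - by apply: cvg_powR_at_right0; rewrite subr_ge0.
  - exact: cvg_cst.
apply: cvg_trans; apply: near_eq_cvg; near=> eta.
have eta0 : 0 < eta by near: eta; exact: nbhs_right_gt.
rewrite /top_moment -/n (shift_pow_prim_homogeneous _ _ eta0).
have etaN0 : forall x y : R, (x + y == 0) ==> (eta != 0).
  by move=> x y; rewrite (gt_eqF eta0) implybT.
have -> : eta `^ (n%:R - r) =
    eta `^ (beta - 1) * eta `^ (n.+1%:R - beta) / eta `^ r.
  by rewrite -powRN -!powRD//; congr (_ `^ _); rewrite -natr1; ring.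
by rewrite powRD// powRN; ring.
Unshelve. all: by end_near. Qed.

End limits.

(** * Limits of the normalized moments and of the correlation *)

Section correlation_limits.
Context {R : realType}.
Implicit Types (beta eta r q : R) (i j n : nat).

(** At order r = 1 < beta - 1 only the homogeneous term contributes. *)
Lemma top_moment_lim00 beta : 2 < beta ->
  top_moment_lim beta 0 0 1 = (beta - 2)^-1.
Proof.
move=> beta2; rewrite /top_moment_lim /shift_pow_prim !big_ord_recr big_ord0/=.
have -> : (beta - 1 - 1 == 0) = false by apply/negbTE; rewrite gt_eqF//; lra.
rewrite subrr eqxx !powR1 subnn !expr0 !expr1 bin0 bin1 addn0.
rewrite mulr0n mulr1n mul0r mul1r.
by field; apply/and3P; split; apply/eqP => ?; lra.
Qed.

Lemma cvg_top_alpha beta : 2 < beta ->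
  top_moment beta eta 0 0 / eta @[eta --> 0^'+] --> ((beta - 2)^-1 : R).
Proof.
move=> beta2; rewrite -top_moment_lim00//.
have : top_moment beta eta 0 0 / eta `^ 1 @[eta --> 0^'+] -->
    (top_moment_lim beta 0 0 1 : R).
  by apply: cvg_top_moment; rewrite //; lra.
apply: cvg_trans; apply: near_eq_cvg; near=> eta.
rewrite powRr1//; near: eta; exact: nbhs_right_ge.
Unshelve. all: by end_near. Qed.

(** Dividing by the mass of the event, of order eta / (beta - 2), costs one power of eta: hence the
    factor beta - 2 and the order r = 1 + (i + j) q. The bounds on q are those of [cvg_top_moment]
    on r. *)
Lemma cvg_top_normalized_moment beta i j q : 2 < beta ->
  (i + j)%:R * q <= beta - 2 -> q <= 1 ->
  top_moment beta eta i j / top_moment beta eta 0 0 / eta `^ ((i + j)%:R * q)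
    @[eta --> 0^'+] -->
    ((beta - 2) * top_moment_lim beta i j (1 + (i + j)%:R * q) : R).
Proof.
move=> beta2 qbeta q1; set s := (i + j)%:R * q.
have : (top_moment beta eta 0 0 / eta)^-1 *
      (top_moment beta eta i j / eta `^ (1 + s)) @[eta --> 0^'+] -->
    ((beta - 2)^-1^-1 * top_moment_lim beta i j (1 + s) : R).
  apply: cvgM; [apply: cvgV; last exact: cvg_top_alpha|apply: cvg_top_moment].
  - by rewrite invr_neq0// gt_eqF// subr_gt0.
  - by rewrite -/s in qbeta; lra.
  - rewrite addSn -nat1r lerD2l -[leRHS]mulr1; apply: ler_wpM2l => //.
rewrite invrK; apply: cvg_trans; apply: near_eq_cvg; near=> eta.
have eta0 : 0 < eta by near: eta; exact: nbhs_right_gt.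
rewrite powRD ?(gt_eqF eta0) ?implybT// powRr1 ?ltW// invf_div.
have etas0 : eta `^ s != 0 by rewrite gt_eqF// powR_gt0.
move: (top_moment beta eta 0 0)^-1 => m.
by field; rewrite etas0 gt_eqF.
Unshelve. all: by end_near. Qed.

(** A common rescaling of U and V leaves the correlation unchanged, which permits normalizing by a
    power of eta before passing to the limit. *)
Lemma correlation_of_moments_scale (s : R) (e : nat -> nat -> R) : 0 < s ->
  correlation_of_moments (fun i j => e i j / s ^+ (i + j)) =
  correlation_of_moments e.
Proof.
move=> s0; rewrite /correlation_of_moments.
set f := fun i j => _.
have vl : var_l f = s ^- 2 * var_l e.
  by rewrite /var_l /f/=; field; rewrite gt_eqF.
have cv : cov_lr f = s ^- 2 * cov_lr e.
  by rewrite /cov_lr /f/=; field; rewrite gt_eqF.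
have vd : var_diff f = s ^- 2 * var_diff e.
  by rewrite /var_diff vl cv /var_r /f/=; field; rewrite gt_eqF.
have -> : var_l f * var_diff f = (s ^- 2) ^+ 2 * (var_l e * var_diff e).
  by rewrite vl vd; ring.
rewrite sqrtrM ?sqr_ge0// sqrtr_sqr ger0_norm ?invr_ge0 ?exprn_ge0 ?ltW//.
rewrite vl cv -mulrBr -mulf_div divff ?mul1r//.
by rewrite invr_neq0// expf_neq0// gt_eqF.
Qed.

(** The correlation is continuous in the first and second moments wherever the product of variances
    is positive. *)
Lemma cvg_correlation_of_moments {T : Type} (F : set_system T) {FF : Filter F}
    (e : T -> nat -> nat -> R) (l : nat -> nat -> R) :
  (forall i j, (i + j <= 2)%N -> e x i j @[x --> F] --> l i j) ->
  0 < var_l l * var_diff l ->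
  correlation_of_moments (e x) @[x --> F] --> correlation_of_moments l.
Proof.
move=> el pos.
have vl : var_l (e x) @[x --> F] --> var_l l.
  by apply: cvgB; [exact: el|apply: cvgM; exact: el].
have vr : var_r (e x) @[x --> F] --> var_r l.
  by apply: cvgB; [exact: el|apply: cvgM; exact: el].
have cv : cov_lr (e x) @[x --> F] --> cov_lr l.
  by apply: cvgB; [exact: el|apply: cvgM; exact: el].
have vd : var_diff (e x) @[x --> F] --> var_diff l.
  apply: cvgB; first exact: cvgD.
  by apply: cvgM => //; exact: cvg_cst.
apply: cvgM; first exact: cvgB.
apply: cvgV; first by rewrite gt_eqF// sqrtr_gt0.
apply: (@cvg_comp _ _ _ _ Num.sqrt _ (nbhs (var_l l * var_diff l))).
  exact: cvgM.
exact: sqrt_continuous.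
Qed.

(** The denominator equals alpha by [top_correlationE], so these are the conditional moments as
    functions of eta alone. *)
Definition top_mean beta eta i j : R :=
  top_moment beta eta i j / top_moment beta eta 0 0.

(* U and Y are normalized by eta^q; the scale q is 1 when beta > 4 and
   (beta - 2) / 2 when beta < 4. *)
Definition top_mean_lim beta q i j : R :=
  (beta - 2) * top_moment_lim beta i j (1 + (i + j)%:R * q).

Lemma cvg_top_correlation beta q (l := top_mean_lim beta q) :
  2 < beta -> 2 * q <= beta - 2 -> 0 <= q <= 1 ->
  0 < var_l l * var_diff l ->
  correlation_of_moments (top_mean beta eta) @[eta --> 0^'+] -->
    correlation_of_moments l.
Proof.
move=> beta2 q2 /andP[q0 q1] pos.
have el i j : (i + j <= 2)%N ->
    top_mean beta eta i j / eta `^ ((i + j)%:R * q) @[eta --> 0^'+] --> l i j.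
  move=> ij; apply: cvg_top_normalized_moment => //.
  by apply: le_trans q2; rewrite ler_wpM2r// ler_nat.
have := cvg_correlation_of_moments
  (e := fun eta i j => top_mean beta eta i j / eta `^ ((i + j)%:R * q)) el pos.
move=> /(_ _); apply: cvg_trans; apply: near_eq_cvg; near=> eta.
have eta0 : 0 < eta by near: eta; exact: nbhs_right_gt.
rewrite -[RHS](@correlation_of_moments_scale (eta `^ q)) ?powR_gt0//.
congr correlation_of_moments; apply/funext => i; apply/funext => j.
by rewrite (mulrC _ q) powRrM powR_mulrn ?powR_ge0.
Unshelve. all: by end_near. Qed.

Lemma divr_sqrt_npos (x y : R) : x <= 0 -> 0 < y ->
  x / Num.sqrt y = - Num.sqrt (x ^+ 2 / y).
Proof.
move=> x0 y0; rewrite sqrtrM ?sqr_ge0// sqrtr_sqr ler0_norm//.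
by rewrite sqrtrV ?ltW// mulNr opprK.
Qed.

End correlation_limits.

(** * Values of the limiting correlation on either side of beta = 4 *)

Section correlation_values.
Context {R : realType}.
Implicit Types (beta q : R) (i j n : nat).

(** A partial fraction identity, checked for each n; the value is minus the Beta integral B(n + 1,
    beta - n - 1). *)
Lemma shift_pow_prim11 beta n : n.+1%:R < beta -> (n <= 3)%N ->
  shift_pow_prim beta 1 n 1 =
  n`!%:R * (-1) ^+ n / \prod_(l < n.+1) (l.+1%:R - beta).
Proof.
move=> nbeta n3; rewrite /shift_pow_prim; under eq_bigr do rewrite powR1 mulr1.
case: n n3 nbeta => [|[|[|[|//]]]] _ nbeta;
  rewrite !big_ord_recr !big_ord0/= !mul1r !add0r.
- by [].
- by field; apply/andP; split; apply/eqP => ?; lra.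
- have -> : 'C(2, 1) = 2%N by [].
  have -> : 2`! = 2%N by [].
  by field; apply/and3P; split; apply/eqP => ?; lra.
- have -> : 'C(3, 1) = 3%N by [].
  have -> : 'C(3, 2) = 3%N by [].
  have -> : 3`! = 6%N by [].
  by field; apply/and4P; split; apply/eqP => ?; lra.
Qed.

(** For q = 1 the order is r = 1 + i + j <= 3 < beta - 1, so only the homogeneous term remains. *)
Lemma top_mean_lim_gt4 beta i j : 4 < beta -> (i + j <= 2)%N ->
  top_mean_lim beta 1 i j = - (beta - 2) * (beta - 1) / i.+1%:R *
    ((i.+1 + j)`!%:R * (-1) ^+ (i.+1 + j) /
     \prod_(l < (i.+1 + j).+1) (l.+1%:R - beta)).
Proof.
move=> beta4 ij; have ijR : (i + j)%:R <= 2 :> R by rewrite ler_nat.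
rewrite /top_mean_lim /top_moment_lim mulr1.
have -> : (beta - 1 - (1 + (i + j)%:R) == 0) = false.
  by apply/negbTE; rewrite gt_eqF//; lra.
rewrite nat1r addSn subrr eqxx mulr0n mulr1n mul0r sub0r mul1r.
rewrite shift_pow_prim11; [ring| |by rewrite ltnS].
by rewrite -!nat1r; lra.
Qed.

(** Here r = beta / 2 lies strictly below both 2 and beta - 1, so neither term has order r. *)
Lemma top_mean_lim_lt4_1 beta i j : 3 < beta < 4 -> (i + j = 1)%N ->
  top_mean_lim beta ((beta - 2) / 2) i j = 0.
Proof.
move=> /andP[beta3 beta4] ij.
rewrite /top_mean_lim /top_moment_lim addSn ij mul1r.
have -> : (beta - 1 - (1 + (beta - 2) / 2) == 0) = false.
  by apply/negbTE; rewrite gt_eqF//; lra.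
have -> : (2 - (1 + (beta - 2) / 2) == 0) = false.
  by apply/negbTE; rewrite gt_eqF//; lra.
by rewrite mulr0n !mul0r subrr !mulr0.
Qed.

(** Here r = beta - 1 < 3, so only the heavy-tail term has order r. *)
Lemma top_mean_lim_lt4_2 beta i j : 3 < beta < 4 -> (i + j = 2)%N ->
  top_mean_lim beta ((beta - 2) / 2) i j =
  (beta - 2) * (beta - 1) / i.+1%:R * ((4 - beta)^-1 - (j.+1%:R - beta)^-1).
Proof.
move=> /andP[beta3 beta4] ij; rewrite /top_mean_lim /top_moment_lim addSn ij.
have -> : 2 * ((beta - 2) / 2) = beta - 2 by field.
have -> : (beta - 1 - (1 + (beta - 2)) == 0) by apply/eqP; ring.
have -> : (3 - (1 + (beta - 2)) == 0) = false.
  by apply/negbTE; rewrite gt_eqF//; lra.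
by rewrite mulr0n mulr1n mul0r subr0 mul1r !mulrA.
Qed.

Lemma correlation_lim_gt4 beta (l := top_mean_lim beta 1) : 4 < beta ->
  0 < var_l l * var_diff l /\
  correlation_of_moments l = - (beta - 2)^-1.
Proof.
move=> beta4.
have prod2 : \prod_(l < 3) (l.+1%:R - beta) =
    (1 - beta) * (2 - beta) * (3 - beta).
  by rewrite !big_ord_recr big_ord0/= mul1r.
have prod3 : \prod_(l < 4) (l.+1%:R - beta) =
    (1 - beta) * (2 - beta) * (3 - beta) * (4 - beta).
  by rewrite !big_ord_recr big_ord0/= mul1r.
have f2 : 2`! = 2%N by []. have f3 : 3`! = 6%N by [].
have l10 : l 1%N 0%N = (beta - 3)^-1.
  rewrite /l top_mean_lim_gt4// prod2 f2; field.
  by repeat (apply/andP; split); apply/eqP => ?; lra.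
have l01 : l 0%N 1%N = 2 / (beta - 3).
  rewrite /l top_mean_lim_gt4// prod2 f2; field.
  by repeat (apply/andP; split); apply/eqP => ?; lra.
have l20 : l 2%N 0%N = 2 / ((beta - 3) * (beta - 4)).
  rewrite /l top_mean_lim_gt4// prod3 f3; field.
  by repeat (apply/andP; split); apply/eqP => ?; lra.
have l11 : l 1%N 1%N = 3 / ((beta - 3) * (beta - 4)).
  rewrite /l top_mean_lim_gt4// prod3 f3; field.
  by repeat (apply/andP; split); apply/eqP => ?; lra.
have l02 : l 0%N 2%N = 6 / ((beta - 3) * (beta - 4)).
  rewrite /l top_mean_lim_gt4// prod3 f3; field.
  by repeat (apply/andP; split); apply/eqP => ?; lra.
rewrite /correlation_of_moments /var_diff /var_l /var_r /cov_lr.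
rewrite l10 l01 l20 l11 l02.
(* The limits of Var(U) and Var(V - U) both equal [v], so the square root of their product is
   [v]. *)
set v := (beta - 2) / ((beta - 3) ^+ 2 * (beta - 4)).
have b30 : beta - 3 != 0 by apply/eqP => ?; lra.
have b40 : beta - 4 != 0 by apply/eqP => ?; lra.
have b20 : beta - 2 != 0 by apply/eqP => ?; lra.
have v0 : 0 < v by rewrite divr_gt0 ?mulr_gt0 ?exprn_gt0//; lra.
have -> : 2 / ((beta - 3) * (beta - 4)) - (beta - 3)^-1 ^+ 2 = v.
  by rewrite /v; field; rewrite b30 b40.
have -> : 6 / ((beta - 3) * (beta - 4)) - (2 / (beta - 3)) ^+ 2 + v -
    2 * (3 / ((beta - 3) * (beta - 4)) - (beta - 3)^-1 * (2 / (beta - 3))) = v.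
  by rewrite /v; field; rewrite b30 b40.
split; first exact: mulr_gt0.
rewrite -expr2 sqrtr_sqr gtr0_norm// /v; field.
by rewrite b30 b40 b20.
Qed.

Lemma correlation_lim_lt4 beta (l := top_mean_lim beta ((beta - 2) / 2)) :
  3 < beta < 4 ->
  0 < var_l l * var_diff l /\
  correlation_of_moments l =
  - Num.sqrt ((beta - 3) / (2 * (beta - 2))).
Proof.
move=> beta34; have /andP[beta3 beta4] := beta34.
have l10 : l 1%N 0%N = 0 by exact: top_mean_lim_lt4_1.
have l01 : l 0%N 1%N = 0 by exact: top_mean_lim_lt4_1.
have l20 := @top_mean_lim_lt4_2 _ 2 0 beta34 erefl.
have l11 := @top_mean_lim_lt4_2 _ 1 1 beta34 erefl.
have l02 := @top_mean_lim_lt4_2 _ 0 2 beta34 erefl.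
rewrite /correlation_of_moments /var_diff /var_l /var_r /cov_lr.
rewrite l10 l01 /l l20 l11 l02.
have b10 : 1 - beta != 0 by apply/eqP => ?; lra.
have b20 : 2 - beta != 0 by apply/eqP => ?; lra.
have b30 : 3 - beta != 0 by apply/eqP => ?; lra.
have b40 : 4 - beta != 0 by apply/eqP => ?; lra.
have b20' : beta - 2 != 0 by apply/eqP => ?; lra.
have b30' : beta - 3 != 0 by apply/eqP => ?; lra.
rewrite [X in X / Num.sqrt _](_ : _ = - (4 - beta)^-1); last first.
  by field; rewrite b40 b20 b10.
set D := (X in 0 < X).
(* The factors are (beta - 2) / (4 - beta) for U and 2 / ((4 - beta) (beta - 3)) for V - U. *)
have DE : D = 2 * (beta - 2) / ((4 - beta) ^+ 2 * (beta - 3)).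
  by rewrite /D; field; rewrite b40 b30' b10 b20 b30.
have D0 : 0 < D by rewrite DE divr_gt0 ?mulr_gt0 ?exprn_gt0//; lra.
split => //; rewrite divr_sqrt_npos//; last first.
  by rewrite oppr_le0 invr_ge0; lra.
congr (- Num.sqrt _); rewrite -/D DE; field.
by rewrite b20' b30' b40.
Qed.

(** The squares of the two candidates differ by (beta - 4) (beta - 1) / (2 (beta - 2)^2), whose sign
    is that of beta - 4. *)
Lemma max_correlation_gt4 beta : 4 < beta ->
  Num.max (- Num.sqrt ((beta - 3) / (2 * (beta - 2)))) (- (beta - 2)^-1) =
  - (beta - 2)^-1.
Proof.
move=> beta4; rewrite max_r// lerN2.
have b20 : 0 < beta - 2 by lra.
have /ger0_norm<- : 0 <= (beta - 2)^-1 by rewrite invr_ge0 ltW.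
rewrite -sqrtr_sqr ler_wsqrtr// -subr_ge0.
have -> : (beta - 3) / (2 * (beta - 2)) - (beta - 2)^-1 ^+ 2 =
    (beta - 4) * (beta - 1) / (2 * (beta - 2) ^+ 2).
  by field; rewrite gt_eqF.
by rewrite divr_ge0 ?mulr_ge0 ?exprn_ge0//; lra.
Qed.

Lemma max_correlation_lt4 beta : 3 < beta < 4 ->
  Num.max (- Num.sqrt ((beta - 3) / (2 * (beta - 2)))) (- (beta - 2)^-1) =
  - Num.sqrt ((beta - 3) / (2 * (beta - 2))).
Proof.
move=> /andP[beta3 beta4]; rewrite max_l// lerN2.
have b20 : 0 < beta - 2 by lra.
have /ger0_norm<- : 0 <= (beta - 2)^-1 by rewrite invr_ge0 ltW.
rewrite -sqrtr_sqr ler_wsqrtr// -subr_ge0.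
have -> : (beta - 2)^-1 ^+ 2 - (beta - 3) / (2 * (beta - 2)) =
    (4 - beta) * (beta - 1) / (2 * (beta - 2) ^+ 2).
  by field; rewrite gt_eqF.
by rewrite divr_ge0 ?mulr_ge0 ?exprn_ge0//; lra.
Qed.

Lemma cvg_correlation beta : 3 < beta -> beta != 4 ->
  correlation_of_moments (top_mean beta eta) @[eta --> 0^'+] -->
  Num.max (- Num.sqrt ((beta - 3) / (2 * (beta - 2)))) (- (beta - 2)^-1).
Proof.
move=> beta3; have beta2 : 2 < beta by lra.
rewrite neq_lt => /orP[beta4|beta4].
- have beta34 : 3 < beta < 4 by rewrite beta3.
  rewrite max_correlation_lt4//.
  have [pos <-] := correlation_lim_lt4 beta34.
  by apply: cvg_top_correlation => //; lra.
- rewrite max_correlation_gt4//.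
  have [pos <-] := correlation_lim_gt4 beta4.
  by apply: cvg_top_correlation => //; lra.
Qed.

End correlation_values.

(** * Change of variable from [eps] to [eta], and conclusion *)

Lemma cvg_mull_at_right0 {R : realType} (k : R) : 0 < k ->
  k * x @[x --> 0^'+] --> (0 : R)^'+.
Proof.
move=> k0 A [e /= e0 eA]; exists (e / k); first by rewrite /= divr_gt0.
move=> x /=; rewrite /ball_/= sub0r normrN => xe x0.
apply: eA; last by rewrite mulr_gt0.
by rewrite /ball_/= sub0r normrN normrM (gtr0_norm k0) mulrC -ltr_pdivlMr.
Qed.

Theorem theorem4 (R : realType) (beta : R)
  (beta_gt3 : 3 < beta) (beta_neq4 : beta != 4)
  (d : R -> measure_display) (T : forall eps : R, measurableType (d eps))
  (P : forall eps : R, probability (T eps) R)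
  (G xi M : forall eps : R, {RV (P eps) >-> R})
  (m : R -> R -> R) (alpha : R -> R)
  (G_uniform : forall eps : R, 0 < eps -> uniform01 (G eps))
  (xi_density : forall eps : R, 0 < eps ->
     has_density (xi eps) (pareto_pdf beta (noise_scale beta eps)))
  (G_xi_indep : forall eps : R, 0 < eps -> independent_RV (G eps) (xi eps))
  (M_def : forall eps : R, 0 < eps ->
     forall w : T eps, M eps w = G eps w + xi eps w)
  (m_quantile : forall eps : R, 0 < eps -> is_top_quantile (M eps) (m eps))
  (alpha_in01 : forall eps : R, 0 < eps -> 0 < alpha eps < 1)
  (m_alpha : forall eps : R, 0 < eps ->
     m eps (alpha eps) = 1 + noise_scale beta eps) :
  alpha eps / (Num.sqrt ((beta - 3) / (beta - 1)) * eps)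
    @[eps --> 0^'+] --> (1 : R)
  /\
  top_correlation (G eps) (M eps) (m eps (alpha eps))
    @[eps --> 0^'+] -->
    Num.max (- Num.sqrt ((beta - 3) / (2 * (beta - 2)))) (- (beta - 2)^-1).
Proof.
have beta2 : 2 < beta by lra.
set s := Num.sqrt ((beta - 3) / (beta - 1)).
have s0 : 0 < s by rewrite sqrtr_gt0 divr_gt0//; lra.
have k0 : 0 < (beta - 2) * s by rewrite mulr_gt0// subr_gt0.
pose eta eps := (beta - 2) * s * eps.
have eta_cvg : eta eps @[eps --> 0^'+] --> (0 : R)^'+.
  exact: cvg_mull_at_right0.
(* Both quantities are explicit functions of eta for every eps > 0, so only limits as eta tends to 0
   from the right remain. *)
have exact_law (eps : R) : 0 < eps ->
    alpha eps = top_moment beta (eta eps) 0 0 /\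
    top_correlation (G eps) (M eps) (m eps (alpha eps)) =
    correlation_of_moments (top_mean beta (eta eps)).
  move=> eps0; have /andP[alpha0 _] := alpha_in01 eps eps0.
  have eta0 : 0 < eta eps by rewrite mulr_gt0.
  have Palpha : P eps [set w | 1 + eta eps <= M eps w] = (alpha eps)%:E.
    by rewrite -(m_quantile eps eps0 _ (alpha_in01 eps eps0)) m_alpha.
  have [alphaE rhoE] := top_correlationE beta_gt3 beta_neq4 eta0 alpha0
    (G_uniform eps eps0) (xi_density eps eps0) (G_xi_indep eps eps0)
    (M_def eps eps0) Palpha.
  by rewrite m_alpha// rhoE /top_mean -alphaE.
split.
(* As eta = (beta - 2) s eps, the ratio alpha / (s eps) equals (beta - 2) alpha / eta. *)
- have : (beta - 2) * (top_moment beta (eta eps) 0 0 / eta eps) @[eps --> 0^'+]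
      --> ((beta - 2) * (beta - 2)^-1 : R).
    apply: cvgM; first exact: cvg_cst.
    exact: (@cvg_comp _ _ _ eta (fun x => top_moment beta x 0 0 / x) _ _ _
      eta_cvg (cvg_top_alpha beta2)).
  rewrite divff ?gt_eqF ?subr_gt0//.
  apply: cvg_trans; apply: near_eq_cvg; near=> eps.
  have eps0 : 0 < eps by near: eps; exact: nbhs_right_gt.
  have [-> _] := exact_law eps eps0; rewrite /eta.
  by field; rewrite !gt_eqF ?subr_gt0.
- have := @cvg_comp _ _ _ eta _ _ _ _ eta_cvg
    (cvg_correlation beta_gt3 beta_neq4).
  apply: cvg_trans; apply: near_eq_cvg; near=> eps.
  have eps0 : 0 < eps by near: eps; exact: nbhs_right_gt.
  by have [_ ->] := exact_law eps eps0.
Unshelve. all: by end_near. Qed.
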